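(* Let $\{Y_t\}_{t\ge1}$ be a pure chaotic $\beta$ARC process with precision parameter $\nu>0$ and conditional mean $\mu_t=T^{t-1}(U_0)$, $t\ge1$ (as defined in the context). Then, for all integers $t,h>0$: 1. $\mathbb{E}(Y_t)=\mathbb{E}(\mu_t)$; 2. $\mathrm{Var}(Y_t)=\mathrm{Var}(\mu_t)+\dfrac{1}{1+\nu}\,\mathbb{E}\big(\mu_t(1-\mu_t)\big)$; 3. $\mathrm{Cov}(Y_t,Y_{t+h})=\mathrm{Cov}(\mu_t,\mu_{t+h})$.
   Context: Pure chaotic $\beta$ARC process: let $T:[0,1]\to[0,1]$ be a Borel measurable map, $T^k$ its $k$-fold composition ($T^0$ the identity), and $U_0$ a random variable with values in $(0,1)$ such that, with probability $1$, $T^t(U_0)\in(0,1)$ for all $t\ge0$. Put $\mu_t=T^{t-1}(U_0)$ for $t\ge1$, and let $\mathscr{F}_{t}$ be the $\sigma$-field generated by $U_0,Y_1,\dots,Y_t$. For each $t\ge 1$, conditionally on $\mathscr{F}_{t-1}$, $Y_t$ has the beta density $$f(y;\mu_t,\nu\mid\mathscr{F}_{t-1})=\frac{\Gamma(\nu)}{\Gamma(\nu\mu_t)\Gamma(\nu(1-\mu_t))}\,y^{\nu\mu_t-1}(1-y)^{\nu(1-\mu_t)-1},\qquad 0<y<1.$$ *)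

(* Defs.v *)
From HB Require Import structures.
From mathcomp Require Export all_boot all_order all_algebra.
From mathcomp Require Export all_classical all_reals all_analysis.
From mathcomp Require Export measurable_realfun.

Set Implicit Arguments.
Unset Strict Implicit.
Unset Printing Implicit Defensive.

Import Order.TTheory GRing.Theory Num.Theory numFieldNormedType.Exports.

Local Open Scope classical_set_scope.
Local Open Scope ring_scope.

Definition Gamma_fun {R : realType} (a : R) : R :=
  \int[lebesgue_measure]_(x in `]0, +oo[) (x `^ (a - 1) * expR (- x)).

(* Beta density in the mean/precision parametrization: the usual shape
   parameters are nu * m and nu * (1 - m). The library's beta_pdf only covers
   natural-number shape parameters. *)
Definition beta_density {R : realType} (nu m y : R) : R :=
  if 0 < y < 1 then
    Gamma_fun nu / (Gamma_fun (nu * m) * Gamma_fun (nu * (1 - m)))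
    * y `^ (nu * m - 1) * (1 - y) `^ (nu * (1 - m) - 1)
  else 0.

(* Conditionally on the sub-sigma-field G, X has density f w: for every Borel
   set B, w |-> \int_B f w y dy is a version of P(X \in B | G). *)
Definition has_cond_density {R : realType} {d : measure_display}
    {Omega : measurableType d} (P : probability Omega R)
    (G : set (set Omega)) (X : Omega -> R) (f : Omega -> R -> R) : Prop :=
  forall B : set R, measurable B ->
    let Z : Omega -> \bar R := fun w =>
      (\int[@lebesgue_measure R]_(y in B) (f w y)%:E)%E in
    (forall C : set (\bar R), measurable C -> G (Z @^-1` C)) /\
    (forall A : set Omega, G A ->
      (\int[P]_(w in A) Z w)%E = P (A `&` X @^-1` B)).

Section bARC.
Context {R : realType} {d : measure_display} {Omega : measurableType d}
  (P : probability Omega R).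

(* T^(t-1)(U0); only meaningful for t >= 1. *)
Definition chaotic_mean (T : R -> R) (U0 : Omega -> R) (t : nat) : Omega -> R :=
  fun w => iter t.-1 T (U0 w).

(* The sigma-field generated by U0, Y_1, ..., Y_t. *)
Definition past (U0 : Omega -> R) (Y : nat -> Omega -> R) (t : nat) :
    set (set Omega) :=
  <<s preimage_set_system setT U0 measurable `|`
      \bigcup_(s in [set s | (1 <= s <= t)%N])
        preimage_set_system setT (Y s) measurable >>.

(* The map T : [0,1] -> [0,1] is represented by a total function on R, whose
   values outside [0,1] are irrelevant. The process is Y_1, Y_2, ...; nothing
   is required of Y 0. *)
Record pure_chaotic_bARC (nu : R) (T : R -> R) (U0 : {RV P >-> R})
    (Y : nat -> {RV P >-> R}) : Prop := {
  bARC_map : forall x : R, 0 <= x <= 1 -> 0 <= T x <= 1 ;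
  bARC_meas : measurable_fun (`[0, 1] : set R) T ;
  bARC_start : forall w, 0 < U0 w < 1 ;
  bARC_orbit : {ae P, forall w, forall t : nat, 0 < iter t T (U0 w) < 1} ;
  bARC_cond : forall t : nat, (1 <= t)%N ->
    has_cond_density P (past U0 (fun s => Y s) t.-1) (Y t)
      (fun w => beta_density nu (chaotic_mean T U0 t w)) }.

End bARC.

(* Main.v *)
(** Write [f_m] for the beta density with mean [m].  Integrating by parts on
    [[eps, 1 - eps]] and letting [eps] tend to 0 gives
    [(a + b) B(a+1,b) = a B(a,b)], whether or not these integrals are finite,
    so that the first two moments of [f_m] are [m * \int f_m] and
    [m (nu m + 1) / (nu + 1) * \int f_m].  The value of the Gamma constants is
    never needed: conditionally on the past, [Y_t] lies in the whole line with
    probability 1, which forces [\int f_(mu_t) = 1] in the conditional sense.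
    Hence [E(W Y_t) = E(W mu_t)] and
    [E(W Y_t^2) = E(W mu_t (nu mu_t + 1) / (nu + 1))] for every nonnegative [W]
    measurable with respect to the past.  Taking [W = 1] gives the mean and the
    variance; for the covariance take first [W = Y_t] at time [t + h], then
    [W = mu_(t+h)] at time [t], which is allowed since [mu_(t+h)] is a function
    of [U0] alone. *)
Require Import Defs.
From mathcomp Require Import ring.
Import Order.TTheory GRing.Theory Num.Theory numFieldNormedType.Exports.
Import HBNNSimple.

Set Implicit Arguments.
Unset Strict Implicit.
Unset Printing Implicit Defensive.

Local Open Scope classical_set_scope.
Local Open Scope ring_scope.
Local Open Scope ereal_scope.

(** * Induction on nonnegative measurable functions and integration against a conditional density *)

(** A nonnegative measurable function is an increasing limit of simple functions, and each of these
    is a finite sum of scaled indicators. Identities between integrals thereby reduce to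
    indicators. *)
Lemma ge0_measurable_ind (R : realType) (d : measure_display)
    (T : measurableType d) (Q : (T -> \bar R) -> Prop) :
  (forall A, measurable A -> Q (fun x => (\1_A x)%:E)) ->
  (forall (k : R) f, (0 <= k)%R -> measurable_fun setT f ->
    (forall x, 0 <= f x) -> Q f -> Q (fun x => k%:E * f x)) ->
  (forall f g, measurable_fun setT f -> measurable_fun setT g ->
    (forall x, 0 <= f x) -> (forall x, 0 <= g x) -> Q f -> Q g ->
    Q (fun x => f x + g x)) ->
  (forall u : nat -> T -> \bar R, (forall n, measurable_fun setT (u n)) ->
    (forall n x, 0 <= u n x) -> (forall x, nondecreasing_seq (u^~ x)) ->
    (forall n, Q (u n)) -> Q (fun x => limn (u^~ x))) ->
  forall f, measurable_fun setT f -> (forall x, 0 <= f x) -> Q f.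
Proof.
move=> Q1 QZ QD QL f mf f0.
(* The sum over the level sets of [h] is taken along an arbitrary list [s] of nonnegative values,
   not just the range of [h], so that induction on the list applies. The empty sum is the indicator
   of the empty set. *)
pose F (h : {nnsfun T >-> R}) s x := \sum_(r <- s) (r * \1_(h @^-1` [set r]) x)%:E.
have Qsum (h : {nnsfun T >-> R}) (s : seq R) : all (fun r => 0 <= r)%R s ->
    [/\ measurable_fun setT (F h s), forall x, 0 <= F h s x & Q (F h s)].
  elim: s => [_|r s IH /= /andP[r0 /IH[ms s0 Qs]]].
    have -> : F h [::] = (fun x => (\1_(@set0 T) x)%:E).
      by apply/funext => x; rewrite /F big_nil indic0.
    split; last exact: Q1.
      by apply/measurable_EFinP; exact: measurable_indic.
      by move=> x; rewrite lee_fin.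
  have mi : measurable_fun setT (fun x => (\1_(h @^-1` [set r]) x : R)%:E).
    by apply/measurable_EFinP; exact: measurable_indic.
  have -> : F h (r :: s) = (fun x => r%:E * (\1_(h @^-1` [set r]) x)%:E + F h s x).
    by apply/funext => x; rewrite /F big_cons EFinM.
  split.
  - apply: emeasurable_funD => //; exact: measurable_funeM.
  - by move=> x; rewrite adde_ge0// lee_fin mulr_ge0.
  - apply: QD => //; first exact: measurable_funeM.
      by move=> x; rewrite mule_ge0// lee_fin.
    by apply: QZ => //; exact: Q1.
have Qnn (h : {nnsfun T >-> R}) : Q (fun x => (h x)%:E).
  have -> : (fun x => (h x)%:E) =
F h (finmap.enum_fset (fset_set (range h))).
    apply/funext => x; by rewrite fimfunE fsbig_finite//= /F sumEFin.
  suff /(Qsum h)[] : all (fun r => 0 <= r)%R (finmap.enum_fset (fset_set (range h))) by [].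
  apply/allP => r rh; have := @in_fset_set _ _ (fimfunP h) r.
  by rewrite [LHS]rh => /esym /set_mem[x _ <-]; exact: fun_ge0.
pose f_ := nnsfun_approx measurableT mf.
have -> : f = (fun x => limn (fun n => (f_ n x)%:E)).
  by apply/funext => z; apply/esym/cvg_lim => //=; exact: cvg_nnsfun_approx.
apply: (QL (fun n x => (f_ n x)%:E)) => //.
- by move=> n; exact/measurable_EFinP.
- by move=> n z; rewrite lee_fin.
- by move=> z a b ab; rewrite lee_fin; exact/lefP/nd_nnsfun_approx.
Qed.

(** For the indicator of a Borel set this is the hypothesis; linearity and monotone convergence give
    the rest. Measurability of the inner integral is proved in the same induction, because the outer
    linearity and convergence steps rely on it. *)
Lemma integral_cond_density (R : realType) (d : measure_display)
    (T : measurableType d) (mu : {measure set T -> \bar R}) (D : set T)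
    (X : T -> R) (f : T -> R -> R) :
  measurable D -> measurable_fun setT X ->
  (forall w, measurable_fun setT (f w)) -> (forall w y, (0 <= f w y)%R) ->
  (forall B, measurable B -> measurable_fun setT
     (fun w => \int[@lebesgue_measure R]_(y in B) (f w y)%:E)) ->
  (forall B, measurable B ->
     \int[mu]_(w in D) (\int[@lebesgue_measure R]_(y in B) (f w y)%:E) =
     mu (D `&` X @^-1` B)) ->
  forall g : R -> \bar R, measurable_fun setT g -> (forall y, 0 <= g y) ->
  measurable_fun setT
    (fun w => \int[@lebesgue_measure R]_y (g y * (f w y)%:E)) /\
  \int[mu]_(w in D) g (X w) =
  \int[mu]_(w in D) (\int[@lebesgue_measure R]_y (g y * (f w y)%:E)).
Proof.
move=> mD mX mf f0 mZ hZ g mg g0.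
pose I (g : R -> \bar R) w := \int[@lebesgue_measure R]_y (g y * (f w y)%:E).
have mfE w : measurable_fun setT (fun y => (f w y)%:E).
  exact/measurable_EFinP.
have mkf (k : R -> \bar R) w : measurable_fun setT k ->
    measurable_fun setT (fun y => k y * (f w y)%:E).
  by move=> mk; exact: emeasurable_funM.
have I0 (k : R -> \bar R) w : (forall y, 0 <= k y) -> 0 <= I k w.
  by move=> k0; apply: integral_ge0 => y _; rewrite mule_ge0// lee_fin.
have mgX (k : R -> \bar R) : measurable_fun setT k ->
    measurable_fun D (fun w => k (X w)).
  move=> mk; apply: (measurable_funS measurableT) => //.
  exact: (measurableT_comp mk).
change (measurable_fun setT (I g) /\
  \int[mu]_(w in D) g (X w) = \int[mu]_(w in D) I g w).
move: g mg g0; apply: ge0_measurable_ind => [B mB|k g k0 mg g0 [mI IE]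
  |g h mg mh g0 h0 [mIg IgE] [mIh IhE]|u mu_ u0 nd_u Hu].
- have -> : I (fun x => (\1_B x)%:E) =
      (fun w => \int[@lebesgue_measure R]_(y in B) (f w y)%:E).
    apply/funext => w; rewrite /I [RHS]integral_mkcond; apply: eq_integral => y _.
    rewrite patchE indicE; case: ifP => _; by rewrite ?mul1e ?mul0e.
  split; first exact: mZ.
  rewrite hZ//.
  rewrite (_ : (fun w => _) = (fun w => (\1_(X @^-1` B) w)%:E)); last first.
    by apply/funext => w.
  rewrite integral_indic//; last by rewrite -[_ @^-1` _]setTI; exact: mX.
  by rewrite setIC.
- have IZ : I (fun x => k%:E * g x) = (fun w => k%:E * I g w).
    apply/funext => w; rewrite /I -ge0_integralZl//.
    + by apply: eq_integral => y _; rewrite muleA.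
    + exact: mkf.
    + by move=> y _; rewrite mule_ge0// lee_fin.
  rewrite IZ; split; first exact: measurable_funeM.
  rewrite ge0_integralZl//; [|exact: mgX].
  rewrite IE [RHS]ge0_integralZl//.
  + exact: (measurable_funS measurableT).
  + by move=> w _; exact: I0.
- have ID : I (fun x => g x + h x) = (fun w => I g w + I h w).
    apply/funext => w; rewrite /I -ge0_integralD//.
    + by apply: eq_integral => y _; rewrite ge0_muleDl.
    + by move=> y _; rewrite mule_ge0// lee_fin.
    + exact: mkf.
    + by move=> y _; rewrite mule_ge0// lee_fin.
    + exact: mkf.
  rewrite ID; split; first exact: emeasurable_funD.
  rewrite ge0_integralD//; [|exact: mgX|exact: mgX].
  rewrite IgE IhE [RHS]ge0_integralD//.
  + by move=> w _; exact: I0.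
  + exact: (measurable_funS measurableT).
  + by move=> w _; exact: I0.
  + exact: (measurable_funS measurableT).
- have IL : I (fun x => limn (u^~ x)) = (fun w => limn (fun n => I (u n) w)).
    apply/funext => w; rewrite /I -monotone_convergence//.
    + apply: eq_integral => y _.
      rewrite muleC -limeMl//; first by under eq_fun do rewrite muleC.
      exact: ereal_nondecreasing_is_cvgn.
    + by move=> n; exact: mkf.
    + by move=> n y _; rewrite mule_ge0// lee_fin.
    + by move=> y _ m n mn; rewrite lee_wpmul2r ?lee_fin//; exact: nd_u.
  have ndI w : nondecreasing_seq (fun n => I (u n) w).
    move=> m n mn; apply: ge0_le_integral => //.
    + by move=> y _; rewrite mule_ge0// lee_fin.
    + exact: mkf.
    + exact: mkf.
    + by move=> y _; rewrite lee_wpmul2r ?lee_fin//; exact: nd_u.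
  rewrite IL; split.
    apply: (emeasurable_fun_cvg (fun n => I (u n))).
      by move=> n; exact: (Hu n).1.
    by move=> w _; apply: ereal_nondecreasing_is_cvgn; exact: ndI.
  rewrite [LHS]monotone_convergence//.
  + rewrite [RHS]monotone_convergence//.
    * by congr (limn _); apply/funext => n; exact: (Hu n).2.
    * by move=> n; apply: (measurable_funS measurableT) => //; exact: (Hu n).1.
    * by move=> n w _; exact: I0.
  + by move=> n; exact: mgX.
Qed.

(** The same induction on [g]. It serves twice: with [W] equal to [mu t], to replace the total mass
    of the density by 1, and with a general weight, to pass from sets of the past to functions. [X1]
    and [X2] are extended-real since that total mass is not known in advance to be finite. *)
Lemma eq_integral_mull_comp (R : realType) (d : measure_display)
    (T : measurableType d) (mu : {measure set T -> \bar R}) (D : set T)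
    (W : T -> R) (X1 X2 : T -> \bar R) :
  measurable D -> measurable_fun setT W ->
  measurable_fun setT X1 -> measurable_fun setT X2 ->
  (forall w, 0 <= X1 w) -> (forall w, 0 <= X2 w) ->
  (forall B, measurable B -> \int[mu]_(w in D `&` W @^-1` B) X1 w =
                             \int[mu]_(w in D `&` W @^-1` B) X2 w) ->
  forall g : R -> \bar R, measurable_fun setT g -> (forall y, 0 <= g y) ->
  \int[mu]_(w in D) (g (W w) * X1 w) = \int[mu]_(w in D) (g (W w) * X2 w).
Proof.
move=> mD mW mX1 mX2 X10 X20 hX.
have mgX (k : R -> \bar R) X : measurable_fun setT k -> measurable_fun setT X ->
    measurable_fun D (fun w => k (W w) * X w).
  move=> mk mX; apply: (measurable_funS measurableT) => //.
  by apply: emeasurable_funM => //; exact: (measurableT_comp mk).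
apply: ge0_measurable_ind => [B mB|k g k0 mg g0 IE
  |g h mg mh g0 h0 IgE IhE|u mu_ u0 nd_u Hu].
- have E X : \int[mu]_(w in D) ((\1_B (W w))%:E * X w) =
    \int[mu]_(w in D `&` W @^-1` B) X w.
    rewrite integral_mkcondr; apply: eq_integral => w _.
    rewrite patchE indicE (_ : (w \in W @^-1` B) = (W w \in B)); last first.
      by apply/idP/idP; rewrite !inE.
    by case: ifP => _; rewrite ?mul1e ?mul0e.
  by rewrite !E hX.
- under eq_integral do rewrite -muleA.
  under [RHS]eq_integral do rewrite -muleA.
  rewrite !ge0_integralZl ?IE//; try exact: mgX; by move=> w _; rewrite mule_ge0.
- under eq_integral do rewrite ge0_muleDl//.
  under [RHS]eq_integral do rewrite ge0_muleDl//.
  rewrite !ge0_integralD ?IgE ?IhE//; try exact: mgX; by move=> w _; rewrite mule_ge0.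
- have E X : measurable_fun setT X -> (forall w, 0 <= X w) ->
    \int[mu]_(w in D) (limn (u^~ (W w)) * X w) =
    limn (fun n => \int[mu]_(w in D) (u n (W w) * X w)).
    move=> mX X0; rewrite -monotone_convergence//.
    + (* [X w] may be [+oo]; the indeterminate products are those with a
         factor [0], for which the sequence is constantly [0]. *)
      apply: eq_integral => w _; apply/esym/cvg_lim => //.
      have cu := ereal_nondecreasing_cvgn (nd_u (W w)).
      have [->|X_neq0] := eqVneq (X w) 0.
        by rewrite mule0; under eq_fun do rewrite mule0; exact: cvg_cst.
      have [l0|l0] := eqVneq (limn (u^~ (W w))) 0.
        have un0 n : u n (W w) = 0.
          apply/eqP; rewrite eq_le u0 andbT -l0 (cvg_lim _ cu)//.
          by apply: ereal_sup_ubound; exists n.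
        by rewrite l0 mul0e; under eq_fun do rewrite un0 mul0e; exact: cvg_cst.
      apply: cvgeM; [|exact: ereal_nondecreasing_is_cvgn|exact: cvg_cst].
      by rewrite mule_defE (negbTE l0) (negbTE X_neq0).
    + by move=> n; exact: mgX.
    + by move=> n w _; rewrite mule_ge0.
    + by move=> w _ m n mn; rewrite lee_wpmul2r//; exact: nd_u.
  by rewrite !E//; congr (limn _); apply/funext.
Qed.

(** * The recursion for beta integrals, by parts on compact subintervals of (0,1) *)

Lemma is_derive_onem_powR (R : realType) (b y : R) : (y < 1)%R ->
  is_derive y 1%R (fun y => - (1 - y) `^ b)%R (b * (1 - y) `^ (b - 1))%R.
Proof.
move=> y1.
have h : (0 < 1 - y)%R by rewrite subr_gt0.
have H1 := is_derive1_powR b h.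
have H2 : is_derive y 1%R (fun y => 1 - y)%R (-1)%R.
  have := is_deriveB (is_derive_cst (1%R : R) y 1%R) (is_derive_id y 1%R).
  by rewrite sub0r.
have H3 := @is_derive1_comp _ _ (fun x : R => 1 - x)%R y _ _ H1 H2.
have := is_deriveN H3.
by rewrite mulrN1 opprK.
Qed.

Lemma measurable_beta_kernel (R : realType) (a b : R) :
  measurable_fun setT (fun y : R => y `^ a * (1 - y) `^ b)%R.
Proof.
apply: measurable_funM; first exact: measurable_powR.
apply: (measurableT_comp (measurable_powR b)).
exact: measurable_funB.
Qed.

Lemma derivable_itv_LRcontinuous (R : realType) (f : R -> R) (l r : R) :
  (l < r)%R -> (forall x, (l <= x <= r)%R -> derivable f x 1%R) ->
  derivable_oo_LRcontinuous f l r.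
Proof.
move=> lr df.
have cf x : (l <= x <= r)%R -> {for x, continuous f}.
  by move=> /df d; apply: differentiable_continuous; exact/derivable1_diffP.
split.
- by move=> x; rewrite in_itv/= => /andP[? ?]; apply: df; rewrite !ltW.
- by apply: cvg_at_right_filter; apply: cf; rewrite lexx ltW.
- by apply: cvg_at_left_filter; apply: cf; rewrite lexx ltW.
Qed.

(** Away from 0 and 1 the kernels are smooth, even when they are unbounded at the endpoints. The
    factors are [y ^ a] and [-(1 - y) ^ b]; the minus sign of the latter cancels the one in front of
    the remaining integral. *)
Lemma integral_beta_by_parts (R : realType) (a b l r : R) :
  (0 < l)%R -> (l < r)%R -> (r < 1)%R -> (0 < a)%R -> (0 < b)%R ->
  \int[@lebesgue_measure R]_(y in `[l, r]) (b * (y `^ a * (1 - y) `^ (b - 1)))%:E =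
  (l `^ a * (1 - l) `^ b - r `^ a * (1 - r) `^ b)%:E +
  \int[@lebesgue_measure R]_(y in `[l, r]) (a * (y `^ (a - 1) * (1 - y) `^ b))%:E.
Proof.
move=> l0 lr r1 a0 b0.
have x01 x : (l <= x <= r)%R -> (0 < x)%R /\ (x < 1)%R.
  by move=> /andP[lx xr]; split; [exact: lt_le_trans lx|exact: le_lt_trans r1].
have dF x (c : R) : (l <= x <= r)%R -> derivable (fun y : R => y `^ c)%R x 1%R.
  by move=> /x01[x0 _]; have [] := is_derive1_powR c x0.
have dG x (c : R) : (l <= x <= r)%R -> derivable (fun y : R => - (1 - y) `^ c)%R x 1%R.
  by move=> /x01[_ x1]; have [] := is_derive_onem_powR c x1.
have sub x : x \in `]l, r[ -> (l <= x <= r)%R.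
  by rewrite in_itv/= => /andP[? ?]; rewrite !ltW.
have E := @integration_by_parts R (fun y => y `^ a)%R (fun y => - (1 - y) `^ b)%R
  (fun y => a * y `^ (a - 1))%R (fun y => b * (1 - y) `^ (b - 1))%R l r lr.
transitivity (\int[@lebesgue_measure R]_(x in `[l, r])
  (x `^ a * (b * (1 - x) `^ (b - 1)))%:E).
  by apply: eq_integral => x _; rewrite mulrCA.
rewrite {}E.
- congr (_ + _); first by rewrite !mulrN opprK (addrC (- _)%R).
  rewrite -[RHS]oppeK; congr (- _); rewrite -integral_ge0N; last first.
    by move=> x _; rewrite lee_fin mulr_ge0 ?(ltW a0)// mulr_ge0 ?powR_ge0.
  by apply: eq_integral => x _; rewrite mulrN -mulrA.
- apply: derivable_within_continuous => x; rewrite in_itv/= => xlr.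
  apply: derivableM; [exact: derivable_cst|exact: dF].
- by apply: derivable_itv_LRcontinuous => // x; exact: dF.
- move=> x /sub/x01[x0 _]; rewrite derive1E.
  by have h := is_derive1_powR a x0; rewrite derive_val.
- apply: derivable_within_continuous => x; rewrite in_itv/= => xlr.
  apply: derivableM; first exact: derivable_cst.
  have /derivableN := dG x (b - 1)%R xlr.
  by under [X in derivable X]eq_fun do rewrite opprK.
- by apply: derivable_itv_LRcontinuous => // x; exact: dG.
- move=> x /sub/x01[_ x1]; rewrite derive1E.
  by have h := is_derive_onem_powR b x1; rewrite derive_val.
Qed.

(** The intervals increase to (0,1), so monotone convergence applies, also when the limit is
    infinite. The shift by 3 makes every interval nondegenerate, starting with [1/3, 2/3]. *)
Lemma cvg_integral_oo01 (R : realType) (f : R -> \bar R) :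
  measurable_fun setT f -> (forall y, 0 <= f y) ->
  \int[@lebesgue_measure R]_(y in `[(n.+3%:R^-1)%R, (1 - n.+3%:R^-1)%R]) f y
    @[n --> \oo] --> \int[@lebesgue_measure R]_(y in `]0%R, 1%R[) f y.
Proof.
move=> mf f0.
pose E (n : nat) : set R := `[(n.+3%:R^-1)%R, (1 - n.+3%:R^-1)%R]%classic.
have -> : `]0%R, 1%R[%classic = \bigcup_n E n.
  apply/seteqP; split => x /=; rewrite ?in_itv/=.
    move=> /andP[x0 x1].
    (* The minimum is the distance from [x] to the endpoints; once 1/(N+3) is below it, the interval
       of index [N] contains [x]. *)
    have m0 : (0 < Num.min x (1 - x))%R by rewrite lt_min x0 subr_gt0.
    have [N _ HN] := near_infty_natSinv_lt (PosNum m0).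
    exists N => //=; rewrite /E/= in_itv/=.
    have /= := HN N.+2 (leq_trans (leqnSn _) (leqnSn _)).
    rewrite lt_min => /andP[xN xN']; rewrite (ltW xN)/=.
    by rewrite lerBrDr addrC -lerBrDr ltW.
  move=> [n _]; rewrite /E/= in_itv/= => /andP[nx xn].
  have n0 : (0 < n.+3%:R^-1 :> R)%R by rewrite invr_gt0.
  by rewrite (lt_le_trans n0 nx) (le_lt_trans xn)// ltrBlDr ltrDl.
apply: (@ge0_nondecreasing_set_cvg_integral _ (measurableTypeR R) R E f lebesgue_measure).
- move=> m n mn; rewrite subsetEset => x; rewrite /E/= !in_itv/= => /andP[mx xm].
  have nm : (n.+3%:R^-1 <= m.+3%:R^-1 :> R)%R by rewrite lef_pV2 ?posrE// ler_nat.
  by rewrite (le_trans nm mx) (le_trans xm)// lerB.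
- by move=> n; exact: measurable_itv.
- by move=> n; exact: (measurable_funS measurableT).
- by move=> n x _.
Qed.

(** In each boundary product one factor tends to 0, its exponent being positive, and the other tends
    to 1. *)
Lemma beta_boundary_cvg0 (R : realType) (a b : R) : (0 < a)%R -> (0 < b)%R ->
  ((n.+3%:R^-1 `^ a * (1 - n.+3%:R^-1) `^ b -
    (1 - n.+3%:R^-1) `^ a * (1 - (1 - n.+3%:R^-1)) `^ b)%R : R) @[n --> \oo] --> 0%R.
Proof.
move=> a0 b0.
have h : (x `^ a * (1 - x) `^ b - (1 - x) `^ a * (1 - (1 - x)) `^ b)%R
    @[x --> 0%R^'+] --> (0 : R)%R.
  have hc (c : R) : ((1 - x) `^ c)%R @[x --> 0%R^'+] --> (1 : R)%R.
    (* The function [(1 - x) ^ c] is differentiable at 0, hence continuous there, with value 1. *)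
    have [d1 _] := is_derive_onem_powR c (@ltr01 R).
    have /derivable1_diffP/differentiable_continuous/cvg_at_right_filter :=
      derivableN d1.
    rewrite (_ : (- _)%R 0%R = 1%R); last by rewrite [LHS]opprK subr0 powR1.
    by apply: cvg_trans; apply: near_eq_cvg; apply: nearW => x; rewrite [LHS]opprK.
  rewrite [X in _ --> X](_ : _ = 0 * 1 - 1 * 0)%R; last by rewrite mul0r mulr0 subr0.
  apply: cvgB; apply: cvgM; [exact: powR_cvg0|exact: hc|exact: hc|].
  by under eq_fun do rewrite subKr; exact: powR_cvg0.
(* The one-sided limit is evaluated along 1/(n+3), the harmonic sequence shifted by 2. *)
have /cvg_at_rightP := h; apply; split.
  by move=> n; rewrite invr_gt0.
have := @cvg_harmonic R; rewrite -(@cvg_shiftn 2).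
by under eq_fun do rewrite /harmonic/= addn2.
Qed.

(** This is [b B(a+1,b) = a B(a,b+1)], obtained by letting the compact intervals grow in the
    integration by parts. The boundary term has the finite limit 0, so limits may be added even if
    the integrals were infinite. *)
Lemma integral_beta_shift (R : realType) (a b : R) : (0 < a)%R -> (0 < b)%R ->
  \int[@lebesgue_measure R]_(y in `]0%R, 1%R[) (b * (y `^ a * (1 - y) `^ (b - 1)))%:E =
  \int[@lebesgue_measure R]_(y in `]0%R, 1%R[) (a * (y `^ (a - 1) * (1 - y) `^ b))%:E.
Proof.
move=> a0 b0.
have mk (c a' b' : R) :
    measurable_fun setT (fun y : R => (c * (y `^ a' * (1 - y) `^ b'))%:E).
  apply/measurable_EFinP; apply: measurable_funM => //.
  exact: measurable_beta_kernel.
have k0 (c a' b' : R) y : (0 < c)%R -> 0 <= (c * (y `^ a' * (1 - y) `^ b'))%:E.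
  by move=> c0; rewrite lee_fin mulr_ge0 ?(ltW c0)// mulr_ge0 ?powR_ge0.
have L := cvg_integral_oo01 (mk b a (b - 1)%R) (fun y => k0 _ _ _ y b0).
have Rr := cvg_integral_oo01 (mk a (a - 1)%R b) (fun y => k0 _ _ _ y a0).
apply: (cvg_unique _ L) => //=.
rewrite -[X in _ --> X]add0e.
have lr n : (n.+3%:R^-1 < 1 - n.+3%:R^-1 :> R)%R.
  rewrite ltrBrDr -mulr2n -[ltLHS]mulr_natl ltr_pdivrMr ?mul1r ?ltr_nat//.
have r1 n : (1 - n.+3%:R^-1 < 1 :> R)%R by rewrite ltrBlDr ltrDl invr_gt0.
under eq_cvg do rewrite integral_beta_by_parts ?invr_gt0//.
apply: cvgeD => //.
apply: cvg_EFin; first exact: nearW.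
exact: beta_boundary_cvg0.
Qed.

(** Splitting [1 = y + (1 - y)] gives [B(a,b) = B(a+1,b) + B(a,b+1)], and the shift identity turns
    [a B(a,b+1)] into [b B(a+1,b)]. No integral is subtracted or divided by, so finiteness does not
    have to be established. *)
Lemma integral_beta_kernel_succ (R : realType) (a b : R) : (0 < a)%R -> (0 < b)%R ->
  (a + b)%:E * \int[@lebesgue_measure R]_(y in `]0%R, 1%R[) (y `^ a * (1 - y) `^ (b - 1))%:E =
  a%:E * \int[@lebesgue_measure R]_(y in `]0%R, 1%R[) (y `^ (a - 1) * (1 - y) `^ (b - 1))%:E.
Proof.
move=> a0 b0.
have mk (a' b' : R) : measurable_fun (`]0%R, 1%R[ : set R)
    (fun y : R => (y `^ a' * (1 - y) `^ b')%:E).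
  apply: (measurable_funS measurableT) => //.
  by apply/measurable_EFinP; exact: measurable_beta_kernel.
have k0 (a' b' y : R) : 0 <= (y `^ a' * (1 - y) `^ b')%:E.
  by rewrite lee_fin mulr_ge0 ?powR_ge0.
have -> : \int[@lebesgue_measure R]_(y in `]0%R, 1%R[) (y `^ (a - 1) * (1 - y) `^ (b - 1))%:E =
   \int[@lebesgue_measure R]_(y in `]0%R, 1%R[) (y `^ a * (1 - y) `^ (b - 1))%:E +
   \int[@lebesgue_measure R]_(y in `]0%R, 1%R[) (y `^ (a - 1) * (1 - y) `^ b)%:E.
  rewrite -ge0_integralD//; [|exact: mk|exact: mk].
  apply: eq_integral => y; rewrite inE/= in_itv/= => /andP[y0 y1].
  rewrite -EFinD; congr EFin.
  rewrite -(mulr_powRB1 (ltW y0) a0) -(@mulr_powRB1 _ (1 - y)%R b) ?subr_ge0 ?(ltW y1)//.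
  by ring.
have X0 : 0 <= \int[@lebesgue_measure R]_(y in `]0%R, 1%R[) (y `^ a * (1 - y) `^ (b - 1))%:E.
  by apply: integral_ge0 => y _.
have Y0 : 0 <= \int[@lebesgue_measure R]_(y in `]0%R, 1%R[) (y `^ (a - 1) * (1 - y) `^ b)%:E.
  by apply: integral_ge0 => y _.
rewrite [RHS]ge0_muleDr// EFinD [LHS]ge0_muleDl ?lee_fin ?ltW//.
congr (_ + _).
rewrite -ge0_integralZl ?lee_fin ?(ltW b0)//; last exact: mk.
rewrite -ge0_integralZl ?lee_fin ?(ltW a0)//; last exact: mk.
under eq_integral do rewrite -EFinM.
under [RHS]eq_integral do rewrite -EFinM.
exact: integral_beta_shift.
Qed.

(** * Moments of the beta density *)

(* The [Y t] of the statement are real-valued and lie in (0,1) only almost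
   surely; clipping makes all moments bounded. *)
Definition clip01 (R : realType) (y : R) : R := if (0 < y < 1)%R then y else 0%R.

Lemma clip01_itv (R : realType) (y : R) : (0 <= clip01 y <= 1)%R.
Proof. by rewrite /clip01; case: ifP => [/andP[? ?]|_]; rewrite ?ler01 ?lexx ?ltW. Qed.

Lemma measurable_clip01 (R : realType) : measurable_fun setT (@clip01 R).
Proof.
rewrite (_ : @clip01 R = fun y => (y * \1_(`]0%R, 1%R[ : set R) y)%R).
  by apply: measurable_funM => //; exact: measurable_indic.
apply/funext => y; rewrite /clip01 indicE.
rewrite (_ : (y \in _) = (0 < y < 1)%R); first by case: ifP; rewrite ?mulr1 ?mulr0.
by apply/idP/idP; rewrite inE/= in_itv.
Qed.

Lemma Gamma_fun_ge0 (R : realType) (a : R) : (0 <= Gamma_fun a)%R.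
Proof.
apply: Rintegral_ge0 => x _.
by rewrite mulr_ge0 ?powR_ge0 ?expR_ge0.
Qed.

Lemma beta_density_ge0 (R : realType) (nu m y : R) : (0 <= beta_density nu m y)%R.
Proof.
rewrite /beta_density; case: ifP => // _.
by rewrite !mulr_ge0 ?powR_ge0 ?invr_ge0 ?mulr_ge0 ?Gamma_fun_ge0.
Qed.

Lemma beta_densityE (R : realType) (nu m : R) :
  beta_density nu m = (fun y =>
   Gamma_fun nu / (Gamma_fun (nu * m) * Gamma_fun (nu * (1 - m)))
   * (y `^ (nu * m - 1) * (1 - y) `^ (nu * (1 - m) - 1))
   * \1_(`]0%R, 1%R[ : set R) y)%R.
Proof.
apply/funext => y; rewrite /beta_density indicE.
rewrite (_ : (y \in _) = (0 < y < 1)%R); first by case: ifP; rewrite ?mulr1 ?mulr0 ?mulrA.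
by apply/idP/idP; rewrite inE/= in_itv.
Qed.

Lemma measurable_beta_density (R : realType) (nu m : R) :
  measurable_fun setT (beta_density nu m).
Proof.
rewrite beta_densityE; apply: measurable_funM; last exact: measurable_indic.
by apply: measurable_funM => //; exact: measurable_beta_kernel.
Qed.

(** Clipping is the identity on (0,1), and the density vanishes elsewhere. All orders share the same
    constant, the order 0 being the total mass, so moments can be compared without evaluating that
    constant. *)
Lemma beta_density_moment (R : realType) (nu m : R) (k : nat) :
  \int[@lebesgue_measure R]_y ((clip01 y ^+ k)%:E * (beta_density nu m y)%:E) =
  (Gamma_fun nu / (Gamma_fun (nu * m) * Gamma_fun (nu * (1 - m))))%:E *
  \int[@lebesgue_measure R]_(y in `]0%R, 1%R[)
     (y `^ (nu * m + k%:R - 1) * (1 - y) `^ (nu * (1 - m) - 1))%:E.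
Proof.
have mk : measurable_fun (`]0%R, 1%R[ : set R)
    (fun y : R => (y `^ (nu * m + k%:R - 1) * (1 - y) `^ (nu * (1 - m) - 1))%:E).
  apply: (measurable_funS measurableT) => //.
  by apply/measurable_EFinP; exact: measurable_beta_kernel.
rewrite -ge0_integralZl//; first last.
- by rewrite lee_fin divr_ge0 ?mulr_ge0 ?Gamma_fun_ge0.
- by move=> y _; rewrite lee_fin mulr_ge0 ?powR_ge0.
rewrite [RHS]integral_mkcond; apply: eq_integral => y _.
rewrite patchE (_ : (y \in _) = (0 < y < 1)%R); last first.
  by apply/idP/idP; rewrite inE/= in_itv.
rewrite /clip01 /beta_density; case: ifP => [/andP[y0 y1]|_]; last by rewrite mule0.
rewrite -!EFinM; congr EFin.
rewrite (_ : nu * m + k%:R - 1 = k%:R + (nu * m - 1))%R; last by ring.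
rewrite (@powRD _ y k%:R); last by rewrite (gt_eqF y0) implybT.
rewrite powR_mulrn ?(ltW y0)//.
ring.
Qed.

(** The shape parameters [nu * m] and [nu * (1 - m)] add up to [nu], so the recursion divided by
    [nu] yields the factor [m]. The total mass stays on the right because it is not evaluated. *)
Lemma beta_density_mean (R : realType) (nu m : R) : (0 < nu)%R -> (0 < m < 1)%R ->
  \int[@lebesgue_measure R]_y ((clip01 y ^+ 1)%:E * (beta_density nu m y)%:E) =
  m%:E * \int[@lebesgue_measure R]_y (beta_density nu m y)%:E.
Proof.
move=> nu0 /andP[m0 m1].
have := beta_density_moment nu m 0.
under eq_integral do rewrite expr0 mul1e; move=> ->.
rewrite beta_density_moment addr0 muleCA; congr (_ * _).
have a0 : (0 < nu * m)%R by rewrite mulr_gt0.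
have b0 : (0 < nu * (1 - m))%R by rewrite mulr_gt0// subr_gt0.
have := integral_beta_kernel_succ a0 b0.
rewrite -mulrDr addrC subrK mulr1 addrK => h.
have := congr1 (fun x => (nu^-1)%:E * x) h.
by rewrite !muleA -!EFinM mulrA mulVf ?gt_eqF// mul1e mul1r.
Qed.

(** The recursion is applied once more, at first parameter [nu * m + 1]; the parameters now add up
    to [nu + 1], which yields the factor [(nu * m + 1) / (nu + 1)] from the first moment to the
    second. *)
Lemma beta_density_second_moment (R : realType) (nu m : R) :
  (0 < nu)%R -> (0 < m < 1)%R ->
  \int[@lebesgue_measure R]_y ((clip01 y ^+ 2)%:E * (beta_density nu m y)%:E) =
  (m * ((nu * m + 1) / (nu + 1)))%:E *
    \int[@lebesgue_measure R]_y (beta_density nu m y)%:E.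
Proof.
move=> nu0 m01; have /andP[m0 m1] := m01.
rewrite mulrC EFinM -muleA -beta_density_mean// !beta_density_moment muleCA.
congr (_ * _).
have a0 : (0 < nu * m + 1)%R by rewrite ltr_wpDl// mulr_ge0// ltW.
have b0 : (0 < nu * (1 - m))%R by rewrite mulr_gt0// subr_gt0.
have := integral_beta_kernel_succ a0 b0.
have n1 : (nu + 1 != 0)%R by rewrite gt_eqF// addr_gt0.
rewrite (_ : nu * m + 1 + nu * (1 - m) = nu + 1)%R; last by ring.
rewrite (_ : nu * m + 2 - 1 = nu * m + 1)%R; last by ring.
move=> h.
have := congr1 (fun x => ((nu + 1)^-1)%:E * x) h.
rewrite !muleA -!EFinM mulVf// mul1e => ->.
by rewrite [((nu + 1)^-1 * _)%R]mulrC.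
Qed.

(** * Expectations and covariances of variables with values in [0,1], and almost sure equality *)

Lemma measurable_unit_Lfun1 (R : realType) (d : measure_display)
    (Omega : measurableType d) (P : probability Omega R) (X : Omega -> R) :
  measurable_fun setT X -> (forall w, 0 <= X w <= 1)%R -> X \in Lfun P 1.
Proof.
move=> mX X01; apply/Lfun1_integrable.
apply: measurable_bounded_integrable => //.
  exact: le_lt_trans (probability_le1 P measurableT) (ltry _).
exists 1%R; split => // r r1 w _ /=.
have /andP[X0 X1] := X01 w.
by rewrite ger0_norm// (le_trans X1)// ltW.
Qed.

Lemma expectation_ae_eq (R : realType) (d : measure_display)
    (Omega : measurableType d) (P : probability Omega R) (X Y : Omega -> R) :
  measurable_fun setT X -> measurable_fun setT Y ->
  {ae P, forall w, X w = Y w} -> 'E_P[X] = 'E_P[Y].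
Proof.
move=> mX mY XY; rewrite unlock; apply: ae_eq_integral => //.
- exact/measurable_EFinP.
- exact/measurable_EFinP.
- by apply: filterS XY => w /= ->.
Qed.

Lemma covariance_ae_eq (R : realType) (d : measure_display)
    (Omega : measurableType d) (P : probability Omega R) (X1 X2 Y1 Y2 : Omega -> R) :
  measurable_fun setT X1 -> measurable_fun setT X2 ->
  measurable_fun setT Y1 -> measurable_fun setT Y2 ->
  {ae P, forall w, X1 w = X2 w} -> {ae P, forall w, Y1 w = Y2 w} ->
  covariance P X1 Y1 = covariance P X2 Y2.
Proof.
move=> mX1 mX2 mY1 mY2 X12 Y12; rewrite !covariance.unlock.
rewrite (expectation_ae_eq mX1 mX2 X12) (expectation_ae_eq mY1 mY2 Y12).
apply: expectation_ae_eq.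
- by apply: measurable_funM; apply: measurable_funB.
- by apply: measurable_funM; apply: measurable_funB.
- by apply: filterS2 X12 Y12 => w Xw Yw; rewrite !fctE /= Xw Yw.
Qed.

Lemma unit_covarianceE (R : realType) (d : measure_display)
    (Omega : measurableType d) (P : probability Omega R) (X Y : Omega -> R) :
  measurable_fun setT X -> (forall w, 0 <= X w <= 1)%R ->
  measurable_fun setT Y -> (forall w, 0 <= Y w <= 1)%R ->
  covariance P X Y = 'E_P[fun w => X w * Y w]%R - 'E_P[X] * 'E_P[Y].
Proof.
move=> mX X01 mY Y01; apply: covarianceE; apply: measurable_unit_Lfun1 => //.
  exact: measurable_funM.
move=> w; have /andP[X0 X1] := X01 w; have /andP[Y0 Y1] := Y01 w.
by rewrite mulr_ge0// mulr_ile1.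
Qed.

(** * The past of the process and its conditional moments *)

Section chaotic_bARC.
Context {R : realType} {d : measure_display} {Omega : measurableType d}
  {P : probability Omega R} {nu : R} {T : R -> R} {U0 : {RV P >-> R}}
  {Y : nat -> {RV P >-> R}}.
Hypothesis HY : pure_chaotic_bARC nu T U0 Y.
Let mu := chaotic_mean T U0.
Let G (t : nat) := past U0 (fun s => Y s) t.

Lemma chaotic_mean_itv t w : (0 <= mu t w <= 1)%R.
Proof.
rewrite /mu /chaotic_mean; elim: t.-1 => [|n IH] /=; last exact: (bARC_map HY).
by have /andP[? ?] := bARC_start HY w; rewrite !ltW.
Qed.

(** [T] is measurable only on [0,1], so the restriction of [T] to [0,1], constant outside, is
    iterated instead; orbits starting in (0,1) never leave [0,1], where both maps agree. *)
Lemma chaotic_mean_comp t : exists2 psi : R -> R,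
  measurable_fun setT psi & mu t = psi \o U0.
Proof.
have mT : measurable_fun setT (T \_ `[0%R, 1%R]).
  by apply: (measurable_restrictT T _).1 (bARC_meas HY).
exists (iter t.-1 (T \_ `[0%R, 1%R])).
  elim: t.-1 => [|n IH] /=; first exact: measurable_id.
  exact: (measurableT_comp mT IH).
apply/funext => w; rewrite /mu /chaotic_mean /=.
have := chaotic_mean_itv ^~ w; rewrite /mu /chaotic_mean.
elim: t.-1 => [//|n IH] I /=; rewrite -IH// patchE mem_set//=.
by rewrite in_itv/=; exact: (I n.+1).
Qed.

Lemma past_U0 t B : measurable B -> G t (U0 @^-1` B).
Proof.
move=> mB; apply: sub_sigma_algebra; left; exists B => //; by rewrite setTI.
Qed.

Lemma past_Y t s B : (0 < s <= t)%N -> measurable B -> G t (Y s @^-1` B).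
Proof.
move=> st mB; apply: sub_sigma_algebra; right; exists s => //.
by exists B => //; rewrite setTI.
Qed.

(** The indices [s] and [t] are unrelated: every [mu s] is a function of [U0], which belongs to
    every past. Future means are thus admissible weights. *)
Lemma past_chaotic_mean t s B : measurable B -> G t (mu s @^-1` B).
Proof.
move=> mB; have [psi mpsi ->] := chaotic_mean_comp s.
by rewrite comp_preimage; apply: past_U0; rewrite -[X in measurable X]setTI; exact: mpsi.
Qed.

Lemma past_measurable t A : G t A -> measurable A.
Proof.
apply: smallest_sub; first exact: sigma_algebra_measurable.
move=> {}A [[B mB <-]|[s _ [B mB <-]]].
- exact: (@measurable_funPT _ _ _ _ U0).
- exact: (@measurable_funPT _ _ _ _ (Y s)).
Qed.

Lemma past_setI t A B : G t A -> G t B -> G t (A `&` B).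
Proof. exact: (@measurableI _ (g_sigma_algebraType _)). Qed.

Lemma past_setT t : G t setT.
Proof. exact: (@measurableT _ (g_sigma_algebraType _)). Qed.

Lemma measurable_chaotic_mean t : measurable_fun setT (mu t).
Proof.
by move=> _ B mB; rewrite setTI; apply: (@past_measurable 0); exact: past_chaotic_mean.
Qed.

Lemma measurable_clip01Y t : measurable_fun setT (fun w => clip01 (Y t w)).
Proof. by apply: (measurableT_comp (@measurable_clip01 R)). Qed.

Lemma chaotic_mean_ae t : {ae P, forall w, 0 < mu t w < 1}%R.
Proof. by apply: filterS (bARC_orbit HY) => w /(_ t.-1). Qed.

(** The density vanishes on the complement of (0,1), so integrating its conditional probability over
    the whole space gives 0. *)
Lemma bARC_clip01_ae t : (0 < t)%N -> {ae P, forall w, Y t w = clip01 (Y t w)}.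
Proof.
move=> t0.
have mB : measurable (~` `]0%R, 1%R[ : set R) by exact: measurableC.
exists (Y t @^-1` ~` `]0%R, 1%R[); split.
- by apply: (@past_measurable t); apply: past_Y; rewrite ?t0/=.
- have GT : G t.-1 setT by exact: past_setT.
  have [_ /(_ setT GT)] := bARC_cond HY t0 mB.
  rewrite setTI => <-; apply: integral0_eq => w _; apply: integral0_eq => y /=.
  by rewrite in_itv /beta_density => /negP/negbTE ->.
- move=> w /= Yw; rewrite in_itv/= => w01; apply: Yw.
  by rewrite /clip01 w01.
Qed.

(** Covers both moments: [k = 1] with [phi] the identity, and [k = 2] with the second-moment factor.
    Sets of the past are treated first, then general weights [W]. *)
Lemma bARC_cond_moment t k (phi : R -> R) (W : Omega -> R) : (0 < t)%N ->
  measurable_fun setT phi -> (forall m, 0 <= m <= 1 -> 0 <= phi m)%R ->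
  (forall m, (0 < m < 1)%R ->
    \int[@lebesgue_measure R]_y ((clip01 y ^+ k)%:E * (beta_density nu m y)%:E) =
    (phi m)%:E * \int[@lebesgue_measure R]_y (beta_density nu m y)%:E) ->
  (forall w, 0 <= W w)%R ->
  (forall B, measurable B -> G t.-1 (W @^-1` B)) ->
  'E_P[fun w => W w * clip01 (Y t w) ^+ k]%R = 'E_P[fun w => W w * phi (mu t w)]%R.
Proof.
move=> t0 mphi phi0 hphi W0 GW.
have mW : measurable_fun setT W.
  by move=> _ B mB; rewrite setTI; exact: past_measurable (GW _ mB).
have mmu := measurable_chaotic_mean t.
have mphimu : measurable_fun setT (fun w => (phi (mu t w))%:E).
  by apply/measurable_EFinP; exact: (measurableT_comp mphi mmu).
have mck : measurable_fun setT (fun y : R => (clip01 y ^+ k)%:E).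
  by apply/measurable_EFinP; apply: measurable_funX; exact: measurable_clip01.
have ck0 (y : R) : 0 <= (clip01 y ^+ k)%:E.
  by rewrite lee_fin exprn_ge0//; have /andP[] := clip01_itv y.
have mcY : measurable_fun setT (fun w => (clip01 (Y t w) ^+ k)%:E).
  by apply: (measurableT_comp mck).
(* Absolute values make the integrands [phi] and the identity nonnegative on the whole line, as the
   induction requires; they change nothing on the values actually taken. *)
have mabs : measurable_fun setT (fun x : R => `|x|%:E).
  by apply/measurable_EFinP; exact: normr_measurable.
have mZ B : measurable B -> measurable_fun setT (fun w =>
    \int[@lebesgue_measure R]_(y in B) (beta_density nu (mu t w) y)%:E).
  move=> mB _ C mC; rewrite setTI.
  by have [+ _] := bARC_cond HY t0 mB; move=> /(_ C mC); exact: past_measurable.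
pose Z w := \int[@lebesgue_measure R]_y (beta_density nu (mu t w) y)%:E.
have Z0 w : 0 <= Z w.
  by apply: integral_ge0 => y _; rewrite lee_fin beta_density_ge0.
have step D : G t.-1 D ->
    \int[P]_(w in D) (clip01 (Y t w) ^+ k)%:E = \int[P]_(w in D) (phi (mu t w))%:E.
  move=> GD; have mD := past_measurable GD.
  have [mI ->] := @integral_cond_density R d Omega P D (Y t)
    (fun w => beta_density nu (mu t w)) mD (@measurable_funPT _ _ _ _ (Y t))
    (fun w => measurable_beta_density _ _) (fun w => beta_density_ge0 _ _) mZ
    (fun B mB => (bARC_cond HY t0 mB).2 D GD) _ mck ck0.
  (* [Z] is the total mass of the density; the conditional density property at
     [B = setT] says that it can be replaced by [1] under the integral. *)
  transitivity (\int[P]_(w in D) (`|phi (mu t w)|%:E * Z w)).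
    apply: ae_eq_integral => //.
    - exact: (measurable_funS measurableT).
    - apply: (measurable_funS measurableT) => //.
      apply: emeasurable_funM; last exact: mZ.
      exact: (measurableT_comp mabs (measurableT_comp mphi mmu)).
    - apply: filterS (chaotic_mean_ae t) => w m01 _.
      by rewrite hphi// ger0_norm// phi0// chaotic_mean_itv.
  rewrite (@eq_integral_mull_comp _ _ _ P D (mu t) Z (cst 1) mD mmu
    (mZ _ measurableT) _ Z0 _ _ (fun x => `|phi x|%:E))//.
  - apply: eq_integral => w _.
    by rewrite mule1 ger0_norm// phi0// chaotic_mean_itv.
  (* [D] cut by an event of [mu t] is still in the past, so the density property over the whole line
     gives its probability as the integral of [Z]. *)
  - move=> B mB; have GDB : G t.-1 (D `&` mu t @^-1` B).
      by apply: past_setI => //; exact: past_chaotic_mean.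
    rewrite integral_cst ?mul1e; last exact: past_measurable GDB.
    have [_ /(_ _ GDB)] := bARC_cond HY t0 measurableT.
    by rewrite preimage_setT setIT.
  - exact: (measurableT_comp mabs mphi).
rewrite unlock.
transitivity (\int[P]_w (`|W w|%:E * (clip01 (Y t w) ^+ k)%:E)).
  by apply: eq_integral => w _; rewrite ger0_norm// EFinM.
rewrite (@eq_integral_mull_comp _ _ _ P setT W _ (fun w => (phi (mu t w))%:E)
    measurableT mW mcY mphimu _ _ _ (fun x => `|x|%:E))//.
- by apply: eq_integral => w _; rewrite ger0_norm// EFinM.
- by move=> w; rewrite lee_fin phi0// chaotic_mean_itv.
- by move=> B mB; rewrite setTI; apply: step; exact: GW.
Qed.

End chaotic_bARC.

(** * The identities for mean, variance and covariance *)

Theorem proposition2p1 (R : realType) (d : measure_display)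
    (Omega : measurableType d) (P : probability Omega R)
    (nu : R) (nu_gt0 : (0 < nu)%R) (T : R -> R)
    (U0 : {RV P >-> R}) (Y : nat -> {RV P >-> R})
    (HY : pure_chaotic_bARC nu T U0 Y)
    (t h : nat) (t_gt0 : (0 < t)%N) (h_gt0 : (0 < h)%N) :
  let mu := chaotic_mean T U0 in
  [/\ 'E_P[Y t] = 'E_P[mu t],
      'V_P[Y t] = 'V_P[mu t]
        + ((1 + nu)^-1)%:E * 'E_P[fun w => (mu t w * (1 - mu t w))%R]
    & covariance P (Y t) (Y (t + h)%N) = covariance P (mu t) (mu (t + h)%N)].
Proof.
move=> mu.
have mY s : measurable_fun setT (Y s) by [].
have mC s := measurable_clip01Y (Y := Y) s.
have C01 s w : (0 <= clip01 (Y s w) <= 1)%R by exact: clip01_itv.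
have mmu s : measurable_fun setT (mu s) := measurable_chaotic_mean HY s.
have mu01 s w : (0 <= mu s w <= 1)%R := chaotic_mean_itv HY s w.
have th_gt0 : (0 < t + h)%N by rewrite addn_gt0 t_gt0.
have mean s (W : Omega -> R) : (0 < s)%N -> (forall w, 0 <= W w)%R ->
    (forall B : set R, measurable B -> past U0 (fun s => Y s) s.-1 (W @^-1` B)) ->
    'E_P[fun w => W w * clip01 (Y s w)]%R = 'E_P[fun w => W w * mu s w]%R.
  move=> s0 W0 GW.
  have := @bARC_cond_moment _ _ _ _ _ _ _ _ HY s 1 id W s0 _ _
    (fun m => beta_density_mean nu_gt0) W0 GW.
  apply; first exact: measurable_id.
  by move=> m /andP[].
have one s (B : set R) : measurable B -> past U0 (fun s => Y s) s (cst (1%R : R) @^-1` B).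
  move=> mB; rewrite preimage_cst; case: ifP => _; last exact: sigma_algebra0.
  exact: past_setT.
have EY s : (0 < s)%N -> 'E_P[fun w => clip01 (Y s w)] = 'E_P[mu s].
  move=> s0; have := mean s (cst 1%R) s0 (fun=> ler01) (one s.-1).
  under eq_fun do rewrite mul1r.
  by under [X in _ = 'E__[X]]eq_fun do rewrite mul1r.
split.
- by rewrite (expectation_ae_eq (mY t) (mC t) (bARC_clip01_ae HY t_gt0)) EY.
- rewrite /variance (covariance_ae_eq (mY t) (mC t) (mY t) (mC t))//;
    try exact: (bARC_clip01_ae HY).
  (* The squared means now agree on both sides, so only second moments remain to be compared. *)
  rewrite !unit_covarianceE// EY// addeAC; congr (_ - _).
  have := @bARC_cond_moment _ _ _ _ _ _ _ _ HY t 2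
    (fun m => m * ((nu * m + 1) / (nu + 1)))%R (cst 1%R) t_gt0 _ _
    (fun m => beta_density_second_moment nu_gt0) (fun=> ler01) (one t.-1).
  move=> E; transitivity 'E_P[fun w => (1 * clip01 (Y t w) ^+ 2)%R].
    by congr expectation; apply/funext => w; rewrite mul1r expr2.
  rewrite E.
  + have m1 : measurable_fun setT (fun w => mu t w * (1 - mu t w))%R.
      by apply: measurable_funM => //; exact: measurable_funB.
    have l1 : (fun w => mu t w * (1 - mu t w))%R \in Lfun P 1.
      apply: measurable_unit_Lfun1 => // w; have /andP[m0 m1'] := mu01 t w.
      by rewrite mulr_ge0 ?subr_ge0// mulr_ile1// ?subr_ge0// lerBlDr lerDl.
    have l2 : (fun w => mu t w * mu t w)%R \in Lfun P 1.
      apply: measurable_unit_Lfun1 => //; first exact: measurable_funM.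
      by move=> w; have /andP[m0 m1'] := mu01 t w; rewrite mulr_ge0// mulr_ile1.
    rewrite -expectationZl// -expectationD// ?Lfun_scale//.
    (* Pointwise, [m (nu m + 1) / (nu + 1) = m^2 + m (1 - m) / (1 + nu)]. *)
    congr expectation; apply/funext => w /=.
    by rewrite -/mu; field; rewrite !gt_eqF ?addr_gt0.
  + apply: measurable_funM => //; apply: measurable_funM => //.
    by apply: measurable_funD => //; apply: measurable_funM.
  + move=> m /andP[m0 m1]; by rewrite mulr_ge0 ?divr_ge0 ?addr_ge0 ?mulr_ge0 ?(ltW nu_gt0).
- rewrite (covariance_ae_eq (mY t) (mC t) (mY (t + h)%N) (mC (t + h)%N))//;
    try exact: (bARC_clip01_ae HY).
  rewrite !unit_covarianceE// !EY//; congr (_ - _).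
  (* First use, at time [t + h] with the clipped [Y t] as weight; the second use, at time [t], has
     weight [mu (t + h)]. *)
  rewrite mean//.
  + transitivity 'E_P[fun w => mu (t + h)%N w * clip01 (Y t w)]%R.
      by congr expectation; apply/funext => w; rewrite mulrC.
    rewrite mean//.
    * by congr expectation; apply/funext => w; rewrite mulrC.
    * by move=> w; have /andP[] := mu01 (t + h)%N w.
    * by move=> B mB; exact: (past_chaotic_mean HY).
  + by move=> w; have /andP[] := C01 t w.
  + move=> B mB; rewrite (_ : _ @^-1` _ = Y t @^-1` (@clip01 R @^-1` B))//.
    (* The relevant past ends at time [t + h - 1], which is at least [t] because [h] is positive. *)
    apply: past_Y; last by rewrite -[X in measurable X]setTI; exact: measurable_clip01.
    by rewrite t_gt0/=; case: h h_gt0 {th_gt0} => // h' _; rewrite addnS/= leq_addr.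
Qed.
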